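(* Let $S,T$ be as in the context. If $\mathrm{Pr}_T(x)$ is a $\Sigma_1$ provability predicate of $T$ satisfying $\mathbf{CB}$, then $T\nvdash\mathrm{RFN}_T(\Delta_0)$.
   Context: $\mathcal{L}_A=\{0,\mathsf{s},+,\times,\leq\}$ is the language of first-order arithmetic, and ''formula'' means $\mathcal{L}_A$-formula; $\ulcorner\varphi\urcorner$ is the numeral of the Gödel number of $\varphi$. $S$ and $T$ are consistent c.e. extensions of Peano Arithmetic $\mathsf{PA}$ in the language $\mathcal{L}_A$ such that $T$ is stronger than $S$ (every theorem of $S$ is a theorem of $T$; $S=T$ is allowed). A formula $\mathrm{Pr}_T(x)$ is a provability predicate of $T$ if for every formula $\varphi$: $T\vdash\varphi$ if and only if $S\vdash\mathrm{Pr}_T(\ulcorner\varphi\urcorner)$. A $\Sigma_1$ provability predicate is one that is a $\Sigma_1$ formula. $\ulcorner\varphi(\vec{\dot{x}})\urcorner$ is a term with free variables $\vec{x}$ for the primitive recursive function that computes from $\vec{n}$ the Gödel number of $\varphi(\overline{\vec{n}})$, the result of substituting the numerals of $\vec{n}$ for $\vec{x}$ in $\varphi(\vec{x})$. $\mathbf{CB}$: $S\vdash\mathrm{Pr}_T(\ulcorner\forall\vec{x}\,\varphi(\vec{x})\urcorner)\to\forall\vec{x}\,\mathrm{Pr}_T(\ulcorner\varphi(\vec{\dot{x}})\urcorner)$ for every formula $\varphi(\vec{x})$. $\mathrm{RFN}_T(\Delta_0)$ is the set $\{\forall\vec{x}\,(\mathrm{Pr}_T(\ulcorner\varphi(\vec{\dot{x}})\urcorner)\to\varphi(\vec{x}))\mid\varphi(\vec{x})\text{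 is a }\Delta_0\text{ formula}\}$; $T\nvdash\mathrm{RFN}_T(\Delta_0)$ means that $T$ fails to prove at least one member of this set. *)

(* Defs.v *)
From Stdlib Require List.
From mathcomp Require Import all_boot.
Set Implicit Arguments.
Unset Strict Implicit.
Unset Printing Implicit Defensive.

Inductive term : Type :=
| Var of nat
| Zero
| Succ of term
| Add of term & term
| Mul of term & term.

Inductive formula : Type :=
| Bot
| Eq of term & term
| Le of term & term
| Imp of formula & formula
| And of formula & formula
| Or of formula & formula
| All of formula
| Ex of formula.

Definition Neg (A : formula) := Imp A Bot.
Definition Iff (A B : formula) := And (Imp A B) (Imp B A).

Fixpoint tsubst (s : nat -> term) (t : term) : term :=
  match t with
  | Var i => s i
  | Zero => Zero
  | Succ t => Succ (tsubst s t)
  | Add t u => Add (tsubst s t) (tsubst s u)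
  | Mul t u => Mul (tsubst s t) (tsubst s u)
  end.

Definition scons (t : term) (s : nat -> term) (i : nat) : term :=
  if i is j.+1 then s j else t.

Definition tlift : term -> term := tsubst (fun i => Var i.+1).

Fixpoint subst (s : nat -> term) (A : formula) : formula :=
  let up := scons (Var 0) (fun i => tlift (s i)) in
  match A with
  | Bot => Bot
  | Eq t u => Eq (tsubst s t) (tsubst s u)
  | Le t u => Le (tsubst s t) (tsubst s u)
  | Imp A B => Imp (subst s A) (subst s B)
  | And A B => And (subst s A) (subst s B)
  | Or A B => Or (subst s A) (subst s B)
  | All A => All (subst up A)
  | Ex A => Ex (subst up A)
  end.

Definition lift : formula -> formula := subst (fun i => Var i.+1).

(* [inst A t]: instantiate index 0 of [A] by [t] and lower the other indices;
   this is A(t) when A has a single free variable. *)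
Definition inst (A : formula) (t : term) : formula := subst (scons t Var) A.

(* [bounded n A]: the free variables of [A] are among the indices 0, ..., n-1. *)
Fixpoint tbounded (n : nat) (t : term) : bool :=
  match t with
  | Var i => i < n
  | Zero => true
  | Succ t => tbounded n t
  | Add t u | Mul t u => tbounded n t && tbounded n u
  end.

Fixpoint bounded (n : nat) (A : formula) : bool :=
  match A with
  | Bot => true
  | Eq t u | Le t u => tbounded n t && tbounded n u
  | Imp A B | And A B | Or A B => bounded n A && bounded n B
  | All A | Ex A => bounded n.+1 A
  end.

Definition sentence (A : formula) : bool := bounded 0 A.

Definition AllN (n : nat) (A : formula) : formula := iter n All A.
Definition ExN (n : nat) (A : formula) : formula := iter n Ex A.

Definition AllLe (t : term) (A : formula) := All (Imp (Le (Var 0) (tlift t)) A).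
Definition ExLe (t : term) (A : formula) := Ex (And (Le (Var 0) (tlift t)) A).

Inductive Delta0 : formula -> Prop :=
| Delta0_Bot : Delta0 Bot
| Delta0_Eq t u : Delta0 (Eq t u)
| Delta0_Le t u : Delta0 (Le t u)
| Delta0_Imp A B : Delta0 A -> Delta0 B -> Delta0 (Imp A B)
| Delta0_And A B : Delta0 A -> Delta0 B -> Delta0 (And A B)
| Delta0_Or A B : Delta0 A -> Delta0 B -> Delta0 (Or A B)
| Delta0_AllLe t A : Delta0 A -> Delta0 (AllLe t A)
| Delta0_ExLe t A : Delta0 A -> Delta0 (ExLe t A).

Definition Sigma1 (A : formula) : Prop :=
  exists n B, Delta0 B /\ A = ExN n B.

Inductive nd : list formula -> formula -> Prop :=
| nd_hyp G A : List.In A G -> nd G A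
| nd_raa G A : nd (Neg A :: G) Bot -> nd G A
| nd_impI G A B : nd (A :: G) B -> nd G (Imp A B)
| nd_impE G A B : nd G (Imp A B) -> nd G A -> nd G B
| nd_andI G A B : nd G A -> nd G B -> nd G (And A B)
| nd_andE1 G A B : nd G (And A B) -> nd G A
| nd_andE2 G A B : nd G (And A B) -> nd G B
| nd_orI1 G A B : nd G A -> nd G (Or A B)
| nd_orI2 G A B : nd G B -> nd G (Or A B)
| nd_orE G A B C : nd G (Or A B) -> nd (A :: G) C -> nd (B :: G) C -> nd G C
| nd_allI G A : nd (map lift G) A -> nd G (All A)
| nd_allE G A t : nd G (All A) -> nd G (inst A t)
| nd_exI G A t : nd G (inst A t) -> nd G (Ex A)
| nd_exE G A C : nd G (Ex A) -> nd (A :: map lift G) (lift C) -> nd G C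
| nd_refl G t : nd G (Eq t t)
| nd_eq G A t u : nd G (Eq t u) -> nd G (inst A t) -> nd G (inst A u).

(* A theory is given by its set of nonlogical axioms. *)
Definition theory := formula -> Prop.

Definition proves (T : theory) (A : formula) : Prop :=
  exists G, (forall B, List.In B G -> T B) /\ nd G A.

Definition consistent (T : theory) : Prop := ~ proves T Bot.

Definition extends (T S : theory) : Prop :=
  forall A, proves S A -> proves T A.

Inductive PA : theory :=
| PA_succ_neq0 : PA (All (Neg (Eq (Succ (Var 0)) Zero)))
| PA_succ_inj :
    PA (All (All (Imp (Eq (Succ (Var 1)) (Succ (Var 0))) (Eq (Var 1) (Var 0)))))
| PA_add0 : PA (All (Eq (Add (Var 0) Zero) (Var 0)))
| PA_addS :
    PA (All (All (Eq (Add (Var 1) (Succ (Var 0))) (Succ (Add (Var 1) (Var 0))))))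
| PA_mul0 : PA (All (Eq (Mul (Var 0) Zero) Zero))
| PA_mulS :
    PA (All (All (Eq (Mul (Var 1) (Succ (Var 0)))
                     (Add (Mul (Var 1) (Var 0)) (Var 1)))))
| PA_le :
    PA (All (All (Iff (Le (Var 1) (Var 0)) (Ex (Eq (Add (Var 2) (Var 0)) (Var 1))))))
| PA_induction n A : bounded n.+1 A ->
    PA (AllN n (Imp (inst A Zero)
               (Imp (All (Imp A (subst (scons (Succ (Var 0)) (fun i => Var i.+1)) A)))
                    (All A)))).

(* Shoenfield-style injective pairing; being a polynomial with coefficients in
   the naturals, it is also given by a term of the language ([tpair]). *)
Definition pairn (a b : nat) : nat := (a + b) * (a + b) + a.
Definition tpair (a b : term) : term := Add (Mul (Add a b) (Add a b)) a.

Fixpoint tgn (t : term) : nat :=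
  match t with
  | Var i => pairn 0 i
  | Zero => pairn 1 0
  | Succ t => pairn 2 (tgn t)
  | Add t u => pairn 3 (pairn (tgn t) (tgn u))
  | Mul t u => pairn 4 (pairn (tgn t) (tgn u))
  end.

Fixpoint gn (A : formula) : nat :=
  match A with
  | Bot => pairn 0 0
  | Eq t u => pairn 1 (pairn (tgn t) (tgn u))
  | Le t u => pairn 2 (pairn (tgn t) (tgn u))
  | Imp A B => pairn 3 (pairn (gn A) (gn B))
  | And A B => pairn 4 (pairn (gn A) (gn B))
  | Or A B => pairn 5 (pairn (gn A) (gn B))
  | All A => pairn 6 (gn A)
  | Ex A => pairn 7 (gn A)
  end.

Definition numeral (n : nat) : term := iter n Succ Zero.

Definition quote (A : formula) : term := numeral (gn A).

Inductive recfun : nat -> Type :=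
| RZero n : recfun n
| RSucc : recfun 1
| RProj n : 'I_n -> recfun n
| RComp m n : recfun m -> ('I_m -> recfun n) -> recfun n
| RPrim n : recfun n -> recfun n.+2 -> recfun n.+1
| RMin n : recfun n.+1 -> recfun n.

(* [computes f x y]: the partial recursive function [f] is defined at [x], with
   value [y]. Primitive recursion is on the first argument, with the step
   function taking (counter, previous value, parameters). *)
Fixpoint computes (n : nat) (f : recfun n) : n.-tuple nat -> nat -> Prop :=
  match f in recfun n return n.-tuple nat -> nat -> Prop with
  | RZero _ => fun _ y => y = 0
  | RSucc => fun x y => y = (thead x).+1
  | RProj _ i => fun x y => y = tnth x i
  | RComp m _ f g => fun x y =>
      exists z : m.-tuple nat,
        (forall i, computes (g i) x (tnth z i)) /\ computes f z y
  | RPrim _ f g => fun x y =>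
      exists v : nat -> nat,
        [/\ computes f [tuple of behead x] (v 0),
            forall i, i < thead x ->
              computes g [tuple of i :: v i :: behead x] (v i.+1)
          & y = v (thead x)]
  | RMin _ f => fun x y =>
      computes f [tuple of y :: x] 0 /\
      forall i, i < y -> exists z, computes f [tuple of i :: x] z.+1
  end.

Definition ce (X : nat -> Prop) : Prop :=
  exists f : recfun 1, forall m, X m <-> exists y, computes f [tuple m] y.

Definition ce_theory (T : theory) : Prop :=
  ce (fun m => exists A, T A /\ gn A = m).

Definition consistent_ce_extension_of_PA (T : theory) : Prop :=
  [/\ forall A, T A -> sentence A, consistent T, ce_theory T & extends T PA].

(* Goedel's beta function: r is the remainder of a modulo 1 + (i + 1) * b. *)
Definition beta (a b i r : term) : formula :=
  And (Le r (Mul (Succ i) b))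
      (ExLe a (Eq (tlift a)
                  (Add (Mul (Var 0) (Succ (Mul (Succ (tlift i)) (tlift b))))
                       (tlift r)))).

(* Graph of the primitive recursive function n |-> tgn (numeral n), with
   argument the variable 0 and value the variable 1: there is a sequence coded
   by (a, b) with entry 0 equal to tgn Zero, with entry i + 1 equal to
   tgn (Succ t) if entry i is tgn t, and whose entry of index n is the value. *)
Definition num_graph : formula :=
  let a := 1 in let b := 0 in let n := 2 in let u := 3 in
  Ex (Ex (And (beta (Var a) (Var b) Zero (numeral (tgn Zero)))
         (And (AllLe (Var n) (Imp (Le (Succ (Var 0)) (Var n.+1))
                 (ExLe (Var a.+1)
                   (And (beta (Var a.+2) (Var b.+2) (Var 1) (Var 0))
                        (beta (Var a.+2) (Var b.+2) (Succ (Var 1))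
                              (tpair (numeral 2) (Var 0)))))))
              (beta (Var a) (Var b) (Var n) (Var u))))).

Definition num_graph_at (x u : term) : formula :=
  subst (scons x (scons u Var)) num_graph.

(* [code_tm k t] and [code_fm k A] compute the Goedel number of the result of
   replacing in [t], resp. [A], the free variable of index i (counted outside
   the k enclosing quantifiers) by the closed term whose Goedel number is the
   value of [Var i]. *)
Fixpoint code_tm (k : nat) (t : term) : term :=
  match t with
  | Var i => if i < k then numeral (tgn (Var i)) else Var (i - k)
  | Zero => numeral (tgn Zero)
  | Succ t => tpair (numeral 2) (code_tm k t)
  | Add t u => tpair (numeral 3) (tpair (code_tm k t) (code_tm k u))
  | Mul t u => tpair (numeral 4) (tpair (code_tm k t) (code_tm k u))
  end.

Fixpoint code_fm (k : nat) (A : formula) : term :=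
  match A with
  | Bot => numeral (gn Bot)
  | Eq t u => tpair (numeral 1) (tpair (code_tm k t) (code_tm k u))
  | Le t u => tpair (numeral 2) (tpair (code_tm k t) (code_tm k u))
  | Imp A B => tpair (numeral 3) (tpair (code_fm k A) (code_fm k B))
  | And A B => tpair (numeral 4) (tpair (code_fm k A) (code_fm k B))
  | Or A B => tpair (numeral 5) (tpair (code_fm k A) (code_fm k B))
  | All A => tpair (numeral 6) (code_fm k.+1 A)
  | Ex A => tpair (numeral 7) (code_fm k.+1 A)
  end.

(* Graph of (x_0, ..., x_(n-1)) |-> gn (A(x_0, ..., x_(n-1))), the x_i being
   replaced in A by their numerals. The value is the variable 0 and the
   argument x_i is the variable i + 1; the n quantified variables are the
   Goedel numbers of the numerals of the x_i. *)
Definition dot_graph (n : nat) (A : formula) : formula :=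
  ExN n (foldr And (Eq (Var n) (code_fm 0 A))
               [seq num_graph_at (Var (n + i).+1) (Var i) | i <- iota 0 n]).

(* P applied to the term for the function of [dot_graph]: this function symbol
   is not in the language, and is eliminated through its graph. The free
   variables are those indexed by 0, ..., n-1, as in A. *)
Definition at_dot (P : formula) (n : nat) (A : formula) : formula :=
  Ex (And (dot_graph n A) (inst P (Var 0))).

Definition provability_predicate (S T : theory) (Pr : formula) : Prop :=
  bounded 1 Pr /\
  forall A : formula, proves T A <-> proves S (inst Pr (quote A)).

Definition CB (S : theory) (Pr : formula) : Prop :=
  forall (n : nat) (A : formula), bounded n A ->
    proves S (Imp (inst Pr (quote (AllN n A))) (AllN n (at_dot Pr n A))).

Definition RFN_Delta0 (Pr : formula) : theory := fun C =>
  exists (n : nat) (A : formula),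
    [/\ bounded n A, Delta0 A & C = AllN n (Imp (at_dot Pr n A) A)].

(* Main.v *)
From Stdlib Require Import Classical_Prop Classical_Pred_Type.
From mathcomp Require Import all_boot zify.
Require Import Defs.
Set Implicit Arguments.
Unset Strict Implicit.
Unset Printing Implicit Defensive.

(* Write Pr = exists ys, B with B in Delta0. There is a sentence sigma that is
   literally a universal closure of a Delta0 formula and that is provably
   equivalent to ~ Pr(sigma). By CB, Pr(sigma) gives the provability of every
   numerical instance of the matrix, and RFN_T(Delta0) then gives the matrix
   itself, so T proves Pr(sigma) -> sigma, hence ~ Pr(sigma), hence sigma; but
   then S, and so T, proves Pr(sigma). *)

(** * Substitution *)

(** [provability_predicate] is a purely external condition: it gives no implication inside [S]
    between the values of [Pr] at provably equivalent sentences. The fixed point therefore cannot be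
    traded for an equivalent universal closure; the sentence whose code is handed to [CB] must
    already have that shape. The usual diagonal lemma does not give this, since it puts the graph of
    the diagonal function under further quantifiers. Two devices keep the matrix bounded. As [pairn]
    is a polynomial, the code of the fixed point is a term in a parameter x and the code u of the
    numeral of x, and substituting a term into [B] preserves [Delta0]. The graph sending x to u
    becomes [Delta0] once a bound w for its witnesses is named, and u and w join the universal
    prefix with the block of [Pr]. The price is that u and w range over everything, so the sentence
    follows from the negation of [Pr] only if the theory proves that u is unique. This is needed for
    one standard x, where external induction and the decision of [Delta0] sentences suffice. *)

Definition up (s : nat -> term) : nat -> term :=
  scons (Var 0) (fun i => tlift (s i)).

Lemma eq_tsubst s r t : s =1 r -> tsubst s t = tsubst r t.
Proof.
move=> e; elim: t => //= [t ->|t -> u ->|t -> u ->] //; exact: e.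
Qed.

Lemma eq_up s r : s =1 r -> up s =1 up r.
Proof. by move=> e [|i] //=; rewrite e. Qed.

Lemma eq_subst s r A : s =1 r -> subst s A = subst r A.
Proof.
elim: A s r => //= [t u|t u|A IA B IB|A IA B IB|A IA B IB|A IA|A IA] s r e.
- by rewrite !(eq_tsubst _ e).
- by rewrite !(eq_tsubst _ e).
- by rewrite (IA _ _ e) (IB _ _ e).
- by rewrite (IA _ _ e) (IB _ _ e).
- by rewrite (IA _ _ e) (IB _ _ e).
- by congr All; apply: IA; apply: eq_up.
- by congr Ex; apply: IA; apply: eq_up.
Qed.

Lemma tsubst_tsubst s r t :
  tsubst s (tsubst r t) = tsubst (fun i => tsubst s (r i)) t.
Proof. by elim: t => //= [t ->|t -> u ->|t -> u ->]. Qed.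

Lemma tsubst_up s t : tsubst (up s) (tlift t) = tlift (tsubst s t).
Proof. by rewrite /tlift !tsubst_tsubst; apply: eq_tsubst. Qed.

Lemma up_comp s r :
  (fun i => tsubst (up s) (up r i)) =1 up (fun i => tsubst s (r i)).
Proof. by case=> [|i] //=; rewrite tsubst_up. Qed.

Lemma subst_subst s r A :
  subst s (subst r A) = subst (fun i => tsubst s (r i)) A.
Proof.
elim: A s r => //= [t u|t u|A IA B IB|A IA B IB|A IA B IB|A IA|A IA] s r.
- by rewrite !tsubst_tsubst.
- by rewrite !tsubst_tsubst.
- by rewrite IA IB.
- by rewrite IA IB.
- by rewrite IA IB.
- by rewrite IA (eq_subst _ (up_comp s r)).
- by rewrite IA (eq_subst _ (up_comp s r)).
Qed.

Lemma tsubst_var t : tsubst Var t = t.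
Proof. by elim: t => //= [t ->|t -> u ->|t -> u ->]. Qed.

Lemma tsubst_scons_tlift t s u : tsubst (scons t s) (tlift u) = tsubst s u.
Proof. by rewrite tsubst_tsubst. Qed.

Lemma subst_inst s A t :
  subst s (inst A t) = inst (subst (up s) A) (tsubst s t).
Proof.
rewrite /inst !subst_subst; apply: eq_subst => -[|i] //=.
by rewrite tsubst_scons_tlift tsubst_var.
Qed.

Lemma subst_up_lift s A : subst (up s) (lift A) = lift (subst s A).
Proof. by rewrite /lift !subst_subst; apply: eq_subst. Qed.

Lemma eq_tsubst_bounded n s r t : tbounded n t ->
  (forall i, i < n -> s i = r i) -> tsubst s t = tsubst r t.
Proof.
move=> + e; elim: t => //= [t IH b|t IHt u IHu|t IHt u IHu].
- by rewrite IH.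
- by case/andP=> /IHt -> /IHu ->.
- by case/andP=> /IHt -> /IHu ->.
Qed.

Lemma eq_subst_bounded n s r A : bounded n A ->
  (forall i, i < n -> s i = r i) -> subst s A = subst r A.
Proof.
have upE m p q : (forall i, i < m -> p i = q i) ->
    forall i, i < m.+1 -> up p i = up q i by move=> e [|i] //= /e ->.
elim: A n s r => //= [t u|t u|A IA B IB|A IA B IB|A IA B IB|A IA|A IA] n s r.
- by case/andP=> bt bu e; rewrite !(eq_tsubst_bounded _ e).
- by case/andP=> bt bu e; rewrite !(eq_tsubst_bounded _ e).
- by case/andP=> bA bB e; rewrite (IA _ _ _ bA e) (IB _ _ _ bB e).
- by case/andP=> bA bB e; rewrite (IA _ _ _ bA e) (IB _ _ _ bB e).
- by case/andP=> bA bB e; rewrite (IA _ _ _ bA e) (IB _ _ _ bB e).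
- by move=> bA e; congr All; apply: IA bA _; apply: upE.
- by move=> bA e; congr Ex; apply: IA bA _; apply: upE.
Qed.

Lemma subst_var A : subst Var A = A.
Proof.
have upV : up Var =1 Var by case.
elim: A => //= [t u|t u|A -> B ->|A -> B ->|A -> B ->|A IA|A IA] //.
- by rewrite !tsubst_var.
- by rewrite !tsubst_var.
- by rewrite (eq_subst _ upV) IA.
- by rewrite (eq_subst _ upV) IA.
Qed.

Lemma subst_sentence s A : sentence A -> subst s A = A.
Proof. by move=> bA; rewrite -[RHS]subst_var; apply: eq_subst_bounded bA _. Qed.

(** Opens a binder: after a shift, the instance at the fresh [Var 0] is the body again. It also
    presents any formula as an instance at [Var 0], the shape that [nd_eq] asks for. *)
Lemma inst_up_lift A : inst (subst (up (fun i => Var i.+1)) A) (Var 0) = A.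
Proof.
rewrite /inst subst_subst -[RHS]subst_var.
by apply: eq_subst => -[].
Qed.

Lemma tsubst_numeral s n : tsubst s (numeral n) = numeral n.
Proof. by elim: n => //= n ->. Qed.

Lemma tlift_numeral n : tlift (numeral n) = numeral n.
Proof. exact: tsubst_numeral. Qed.

Lemma tbounded_tsubst k m s t : tbounded k t ->
  (forall i, i < k -> tbounded m (s i)) -> tbounded m (tsubst s t).
Proof.
move=> + bs; elim: t => //= [t IHt u IHu|t IHt u IHu].
- by case/andP=> /IHt -> /IHu ->.
- by case/andP=> /IHt -> /IHu ->.
Qed.

Lemma tbounded_up k m s : (forall i, i < k -> tbounded m (s i)) ->
  forall i, i < k.+1 -> tbounded m.+1 (up s i).
Proof. by move=> bs [|i] //= /bs bi; apply: tbounded_tsubst bi _. Qed.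

Lemma bounded_subst k m s A : bounded k A ->
  (forall i, i < k -> tbounded m (s i)) -> bounded m (subst s A).
Proof.
elim: A k m s => //= [t u|t u|A IA B IB|A IA B IB|A IA B IB|A IA|A IA] k m s.
- by case/andP=> bt bu bs; rewrite !(tbounded_tsubst _ bs).
- by case/andP=> bt bu bs; rewrite !(tbounded_tsubst _ bs).
- by case/andP=> bA bB bs; rewrite (IA _ _ _ bA bs) (IB _ _ _ bB bs).
- by case/andP=> bA bB bs; rewrite (IA _ _ _ bA bs) (IB _ _ _ bB bs).
- by case/andP=> bA bB bs; rewrite (IA _ _ _ bA bs) (IB _ _ _ bB bs).
- by move=> bA bs; apply: IA bA _; apply: tbounded_up.
- by move=> bA bs; apply: IA bA _; apply: tbounded_up.
Qed.

Lemma tbounded_numeral k n : tbounded k (numeral n).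
Proof. by elim: n. Qed.

Lemma subst_AllLe s t A :
  subst s (AllLe t A) = AllLe (tsubst s t) (subst (up s) A).
Proof. by rewrite /AllLe /= tsubst_up. Qed.

Lemma subst_ExLe s t A :
  subst s (ExLe t A) = ExLe (tsubst s t) (subst (up s) A).
Proof. by rewrite /ExLe /= tsubst_up. Qed.

Lemma Delta0_subst s A : Delta0 A -> Delta0 (subst s A).
Proof.
move=> dA; elim: dA s => {A} [|||A B _ IA _ IB|A B _ IA _ IB|A B _ IA _ IB
  |t A _ IA|t A _ IA] *; rewrite ?subst_AllLe ?subst_ExLe; by constructor.
Qed.

Lemma subst_ExN s n A : subst s (ExN n A) = ExN n (subst (iter n up s) A).
Proof. by elim: n s => //= n IH s; rewrite IH -iterSr. Qed.

Lemma bounded_ExN k n A : bounded k (ExN n A) = bounded (n + k) A.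
Proof. by elim: n k => //= n IH k; rewrite IH addnS. Qed.

Lemma bounded_iter_lift k n A : bounded k A -> bounded (n + k) (iter n lift A).
Proof. by move=> bA; elim: n => //= n IH; apply: bounded_subst IH _. Qed.

Lemma tbounded_iter_up n k m s : (forall i, i < k -> tbounded m (s i)) ->
  forall i, i < n + k -> tbounded (n + m) (iter n up s i).
Proof. by move=> bs; elim: n => //= n IH; apply: tbounded_up. Qed.

(** * Natural deduction over a theory of sentences *)

Lemma In_cat (G H : seq formula) A :
  List.In A (G ++ H) <-> List.In A G \/ List.In A H.
Proof. by elim: G => //= [|B G ->]; tauto. Qed.

Lemma In_map (f : formula -> formula) G A :
  List.In A (map f G) <-> exists2 B, List.In B G & A = f B.
Proof.
elim: G => /= [|B G ->]; first by split=> // -[].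
split=> [[<-|[C GC ->]]|[C [<-|GC] ->]]; [by exists B; auto| |by auto|].
- by exists C; auto.
- by right; exists C.
Qed.

Lemma map_sub (f : formula -> formula) (G H : seq formula) :
  (forall A, List.In A G -> List.In A H) ->
  forall A, List.In A (map f G) -> List.In A (map f H).
Proof. by move=> GH A /In_map [B /GH HB ->]; apply/In_map; exists B. Qed.

Lemma cons_sub (G H : seq formula) B : (forall A, List.In A G -> List.In A H) ->
  forall A, List.In A (B :: G) -> List.In A (B :: H).
Proof. by move=> GH A /= [->|/GH]; auto. Qed.

Lemma nd_weak G H A : nd G A ->
  (forall B, List.In B G -> List.In B H) -> nd H A.
Proof.
move=> d; elim: d H => {G A} [G A GA|G A _ IH|G A B _ IH|G A B _ IHA _ IHB
  |G A B _ IHA _ IHB|G A B _ IH|G A B _ IH|G A B _ IH|G A B _ IH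
  |G A B C _ IH _ IHA _ IHB|G A _ IH|G A t _ IH|G A t _ IH|G A C _ IHA _ IHC
  |G t|G A t u _ IHe _ IHA] H GH.
- exact/nd_hyp/GH.
- by apply: nd_raa; apply: IH; apply: cons_sub.
- by apply: nd_impI; apply: IH; apply: cons_sub.
- by apply: (nd_impE (A := A)); auto.
- by apply: nd_andI; auto.
- by apply: (nd_andE1 (B := B)); auto.
- by apply: (nd_andE2 (A := A)); auto.
- by apply: nd_orI1; auto.
- by apply: nd_orI2; auto.
- apply: (nd_orE (A := A) (B := B)); first by auto.
    by apply: IHA; apply: cons_sub.
  by apply: IHB; apply: cons_sub.
- by apply: nd_allI; apply: IH; apply: map_sub.
- by apply: nd_allE; auto.
- by apply: (nd_exI (t := t)); auto.
- apply: (nd_exE (A := A)); first by auto.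
  by apply: IHC; apply: cons_sub; apply: map_sub.
- exact: nd_refl.
- by apply: (nd_eq (t := t)); auto.
Qed.

Lemma map_subst_up s G :
  map (subst (up s)) (map lift G) = map lift (map (subst s) G).
Proof. by rewrite -!map_comp; apply: eq_map => A /=; apply: subst_up_lift. Qed.

(** The eigenvariable rules carry over because [up] commutes with [lift]. Facts proved for variables
    thereby become facts about arbitrary terms. *)
Lemma nd_subst s G A : nd G A -> nd (map (subst s) G) (subst s A).
Proof.
move=> d; elim: d s => {G A} [G A GA|G A _ IH|G A B _ IH|G A B _ IHA _ IHB
  |G A B _ IHA _ IHB|G A B _ IH|G A B _ IH|G A B _ IH|G A B _ IH
  |G A B C _ IH _ IHA _ IHB|G A _ IH|G A t _ IH|G A t _ IH|G A C _ IHA _ IHC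
  |G t|G A t u _ IHe _ IHA] s /=.
- by apply: nd_hyp; apply/In_map; exists A.
- by apply: nd_raa; apply: IH.
- by apply: nd_impI; apply: IH.
- exact: nd_impE (IHA s) (IHB s).
- exact: nd_andI (IHA s) (IHB s).
- exact: nd_andE1 (IH s).
- exact: nd_andE2 (IH s).
- exact: nd_orI1 (IH s).
- exact: nd_orI2 (IH s).
- exact: nd_orE (IH s) (IHA s) (IHB s).
- by apply: nd_allI; rewrite -map_subst_up; apply: IH.
- by rewrite subst_inst; apply: nd_allE; apply: IH.
- by apply: (nd_exI (t := tsubst s t)); rewrite -subst_inst; apply: IH.
- apply: nd_exE (IHA s) _.
  by rewrite -map_subst_up -subst_up_lift; apply: IHC.
- exact: nd_refl.
- rewrite subst_inst; apply: nd_eq (IHe s) _.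
  by rewrite -subst_inst; apply: IHA.
Qed.

(** Hypotheses are kept apart from the axioms used: the quantifier rules shift [G], while axioms
    that are sentences stay fixed. For empty [G] this is [proves T A] by conversion. *)
Definition ent (T : theory) (G : seq formula) (A : formula) : Prop :=
  exists H, (forall B, List.In B H -> T B) /\ nd (G ++ H) A.

Lemma ent_weak T G G' A : ent T G A ->
  (forall B, List.In B G -> List.In B G') -> ent T G' A.
Proof.
move=> [H [TH d]] GG'; exists H; split=> //.
by apply: nd_weak d _ => B /In_cat [/GG'|] ?; apply/In_cat; auto.
Qed.

Lemma ent0 T G A : ent T [::] A -> ent T G A.
Proof. by move=> d; apply: ent_weak d _. Qed.

Lemma ent_cons T G A B : ent T G A -> ent T (B :: G) A.
Proof. by move=> d; apply: ent_weak d _ => C; right. Qed.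

Lemma ent_hyp T G A : List.In A G -> ent T G A.
Proof.
by move=> GA; exists [::]; split=> //; apply: nd_hyp; apply/In_cat; left.
Qed.

Lemma ent_hd T G A : ent T (A :: G) A.
Proof. by apply: ent_hyp; left. Qed.

Lemma ent_lift1 T G A B :
  (forall G', nd (G ++ G') A -> nd (G ++ G') B) -> ent T G A -> ent T G B.
Proof. by move=> AB [H [TH d]]; exists H; split=> //; apply: AB. Qed.

(** Two derivations bring two lists of axioms, and the rule is applied over their concatenation.
    That the common list lies in [T] is passed on for [ent_exE], which must know that shifting
    leaves it unchanged. *)
Lemma ent_lift2 T G G1 G2 A B C :
  (forall H, (forall D, List.In D H -> T D) ->
     nd (G1 ++ H) A -> nd (G2 ++ H) B -> nd (G ++ H) C) ->
  ent T G1 A -> ent T G2 B -> ent T G C.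
Proof.
move=> ABC [H1 [TH1 d1]] [H2 [TH2 d2]]; exists (H1 ++ H2).
have TH D : List.In D (H1 ++ H2) -> T D by move=> /In_cat [/TH1|/TH2].
split=> //; apply: ABC => //.
  by apply: nd_weak d1 _ => D; rewrite !In_cat; tauto.
by apply: nd_weak d2 _ => D; rewrite !In_cat; tauto.
Qed.

Lemma ent_impI T G A B : ent T (A :: G) B -> ent T G (Imp A B).
Proof. by move=> [H [TH d]]; exists H; split=> //; apply: nd_impI. Qed.

Lemma ent_impE T G A B : ent T G (Imp A B) -> ent T G A -> ent T G B.
Proof. by apply: ent_lift2 => H _; apply: nd_impE. Qed.

Lemma ent_andI T G A B : ent T G A -> ent T G B -> ent T G (And A B).
Proof. by apply: ent_lift2 => H _; apply: nd_andI. Qed.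

Lemma ent_andE1 T G A B : ent T G (And A B) -> ent T G A.
Proof. by apply: ent_lift1 => H; apply: nd_andE1. Qed.

Lemma ent_andE2 T G A B : ent T G (And A B) -> ent T G B.
Proof. by apply: ent_lift1 => H; apply: nd_andE2. Qed.

Lemma ent_orI1 T G A B : ent T G A -> ent T G (Or A B).
Proof. by apply: ent_lift1 => H; apply: nd_orI1. Qed.

Lemma ent_orI2 T G A B : ent T G B -> ent T G (Or A B).
Proof. by apply: ent_lift1 => H; apply: nd_orI2. Qed.

Lemma ent_orE T G A B C : ent T G (Or A B) ->
  ent T (A :: G) C -> ent T (B :: G) C -> ent T G C.
Proof.
(* The three derivations are bundled into one conjunction, so that a single list of axioms serves
   them all. *)
move=> dAB /ent_impI dA /ent_impI dB.
have := ent_andI dAB (ent_andI dA dB); apply: ent_lift1 => H d.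
have d2 := nd_andE2 d.
apply: nd_orE (nd_andE1 d) _ _; apply: nd_impE (nd_hyp _); try by left.
  by apply: nd_weak (nd_andE1 d2) _ => D; right.
by apply: nd_weak (nd_andE2 d2) _ => D; right.
Qed.

Lemma ent_raa T G A : ent T (Neg A :: G) Bot -> ent T G A.
Proof. by move=> [H [TH d]]; exists H; split=> //; apply: nd_raa. Qed.

Lemma ent_bot T G A : ent T G Bot -> ent T G A.
Proof. by move=> d; apply: ent_raa; apply: ent_cons. Qed.

Lemma ent_allE T G A t : ent T G (All A) -> ent T G (inst A t).
Proof. by apply: ent_lift1 => H; apply: nd_allE. Qed.

Lemma ent_exI T G A t : ent T G (inst A t) -> ent T G (Ex A).
Proof. by apply: ent_lift1 => H; apply: nd_exI. Qed.

Lemma ent_refl T G t : ent T G (Eq t t).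
Proof. by exists [::]; split=> //; apply: nd_refl. Qed.

Lemma ent_eq T G A t u :
  ent T G (Eq t u) -> ent T G (inst A t) -> ent T G (inst A u).
Proof. by apply: ent_lift2 => H _; apply: nd_eq. Qed.

Lemma ent_cut T G A B : ent T G A -> ent T (A :: G) B -> ent T G B.
Proof. by move=> dA /ent_impI dB; apply: ent_impE dB dA. Qed.

Lemma ent_sym T G t u : ent T G (Eq t u) -> ent T G (Eq u t).
Proof.
move=> e; have := @ent_eq T G (Eq (Var 0) (tlift t)) t u e.
rewrite /inst /= !tsubst_scons_tlift !tsubst_var; apply; exact: ent_refl.
Qed.

Lemma ent_trans T G t u v :
  ent T G (Eq t u) -> ent T G (Eq u v) -> ent T G (Eq t v).
Proof.
move=> e e'; have := @ent_eq T G (Eq (tlift t) (Var 0)) u v e'.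
by rewrite /inst /= !tsubst_scons_tlift !tsubst_var; apply.
Qed.

Lemma ent_eqS T G t u : ent T G (Eq t u) -> ent T G (Eq (Succ t) (Succ u)).
Proof.
move=> e; have := @ent_eq T G (Eq (tlift (Succ t)) (Succ (Var 0))) t u e.
rewrite /inst /= !tsubst_scons_tlift !tsubst_var; apply; exact: ent_refl.
Qed.

Lemma ent_eqD T G t t' u u' : ent T G (Eq t t') -> ent T G (Eq u u') ->
  ent T G (Eq (Add t u) (Add t' u')).
Proof.
move=> e e'; apply: (@ent_trans _ _ _ (Add t' u)).
  have := @ent_eq T G (Eq (tlift (Add t u)) (Add (Var 0) (tlift u))) t t' e.
  rewrite /inst /= !tsubst_scons_tlift !tsubst_var; apply; exact: ent_refl.
have := @ent_eq T G (Eq (tlift (Add t' u)) (Add (tlift t') (Var 0))) u u' e'.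
rewrite /inst /= !tsubst_scons_tlift !tsubst_var; apply; exact: ent_refl.
Qed.

Lemma ent_eqM T G t t' u u' : ent T G (Eq t t') -> ent T G (Eq u u') ->
  ent T G (Eq (Mul t u) (Mul t' u')).
Proof.
move=> e e'; apply: (@ent_trans _ _ _ (Mul t' u)).
  have := @ent_eq T G (Eq (tlift (Mul t u)) (Mul (Var 0) (tlift u))) t t' e.
  rewrite /inst /= !tsubst_scons_tlift !tsubst_var; apply; exact: ent_refl.
have := @ent_eq T G (Eq (tlift (Mul t' u)) (Mul (tlift t') (Var 0))) u u' e'.
rewrite /inst /= !tsubst_scons_tlift !tsubst_var; apply; exact: ent_refl.
Qed.

Lemma ent_le T G t t' u u' : ent T G (Eq t t') -> ent T G (Eq u u') ->
  ent T G (Le t u) -> ent T G (Le t' u').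
Proof.
move=> e e' d; have := @ent_eq T G (Le (tlift t') (Var 0)) u u' e'.
rewrite /inst /= !tsubst_scons_tlift !tsubst_var; apply.
have := @ent_eq T G (Le (Var 0) (tlift u)) t t' e.
by rewrite /inst /= !tsubst_scons_tlift !tsubst_var; apply.
Qed.

Section SentenceTheory.

Variable T : theory.
Hypothesis sT : forall A, T A -> sentence A.

Lemma map_subst_theory s H :
  (forall B, List.In B H -> T B) -> map (subst s) H = H.
Proof.
elim: H => //= A H IH TH; rewrite IH; last by move=> B HB; apply: TH; right.
by rewrite subst_sentence //; apply: sT; apply: TH; left.
Qed.

Lemma ent_subst s G A : ent T G A -> ent T (map (subst s) G) (subst s A).
Proof.
move=> [H [TH d]]; exists H; split=> //.
by have := nd_subst s d; rewrite map_cat (map_subst_theory _ TH).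
Qed.

Lemma ent_allI G A : ent T (map lift G) A -> ent T G (All A).
Proof.
move=> [H [TH d]]; exists H; split=> //; apply: nd_allI.
by rewrite map_cat (map_subst_theory _ TH).
Qed.

Lemma ent_exE G A C :
  ent T G (Ex A) -> ent T (A :: map lift G) (lift C) -> ent T G C.
Proof.
apply: ent_lift2 => H TH dA dC; apply: nd_exE dA _.
by rewrite map_cat (map_subst_theory _ TH).
Qed.

Lemma map_iter_lift n (G : seq formula) :
  map (iter n lift) (map lift G) = map (iter n.+1 lift) G.
Proof. by rewrite -map_comp; apply: eq_map => A; rewrite [RHS]iterSr. Qed.

Lemma ent_allN_I n G A : ent T (map (iter n lift) G) A -> ent T G (AllN n A).
Proof.
elim: n G => [|n IH] G; first by rewrite map_id.
by rewrite -map_iter_lift => d; apply: ent_allI; apply: IH.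
Qed.

Lemma ent_allN_E n G A : ent T G (AllN n A) -> ent T (map (iter n lift) G) A.
Proof.
elim: n G => [|n IH] G d; first by rewrite map_id.
rewrite -map_iter_lift; apply: IH.
have /(ent_allE (Var 0)) := ent_subst (fun i => Var i.+1) d.
by rewrite inst_up_lift.
Qed.

Lemma ent_exN_E n G A C :
  ent T G (ExN n A) -> ent T (A :: map (iter n lift) G) (iter n lift C) ->
  ent T G C.
Proof.
elim: n G C => [|n IH] G C dA dC.
  by rewrite map_id in dC; apply: ent_cut dA dC.
apply: ent_exE dA _; apply: IH (ent_hd _ _ _) _.
rewrite -iterSr; apply: ent_weak dC _; apply: cons_sub => B.
by rewrite -map_iter_lift; right.
Qed.

Lemma ent_lift_ex G A : ent T (A :: G) (lift (Ex A)).
Proof.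
by apply: (ent_exI (t := Var 0)); rewrite inst_up_lift; apply: ent_hd.
Qed.

Lemma ent_iter_lift n G A :
  ent T G A -> ent T (map (iter n lift) G) (iter n lift A).
Proof.
elim: n G A => [|n IH] G A d; first by rewrite map_id.
by rewrite -map_iter_lift iterSr; apply: IH; apply: ent_subst.
Qed.

(** The free variables of [A] are their own witnesses, one quantifier at a time. *)
Lemma ent_exN_I n G A : ent T (A :: G) (iter n lift (ExN n A)).
Proof.
elim: n => [|n IH]; first exact: ent_hd.
apply: ent_cut IH _; rewrite iterSr.
apply: ent_weak (ent_iter_lift n (ent_lift_ex [::] _)) _.
by move=> B [<-|//]; left.
Qed.

Lemma iter_lift_Imp n A B :
  iter n lift (Imp A B) = Imp (iter n lift A) (iter n lift B).
Proof. by elim: n => //= n ->. Qed.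

Lemma iter_lift_Bot n : iter n lift Bot = Bot.
Proof. by elim: n => //= n ->. Qed.

(** Takes a block of existential quantifiers out of the negation as a universal prefix. Applied to
    the block of [Pr], it leaves a bounded matrix. *)
Lemma ent_prenex n G A B C :
  ent T G (AllN n (Imp (iter n lift A) (Imp (iter n lift B) (Neg C)))) <->
  ent T G (Imp A (Imp B (Neg (ExN n C)))).
Proof.
split=> d.
  apply: ent_impI; apply: ent_impI; apply: ent_impI.
  apply: ent_exN_E (ent_hd _ _ _) _; rewrite iter_lift_Bot.
  have {}d := ent_allN_E d; apply: ent_impE (ent_hd _ _ _).
  apply: (ent_impE (A := iter n lift B)); last by apply: ent_hyp => /=; auto.
  apply: (ent_impE (A := iter n lift A)); last by apply: ent_hyp => /=; auto.
  by apply: ent_weak d _ => D /=; auto.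
apply: ent_allN_I; apply: ent_impI; apply: ent_impI; apply: ent_impI.
have := ent_iter_lift n d; rewrite !iter_lift_Imp iter_lift_Bot => {}d.
apply: ent_impE (ent_exN_I n _ C).
apply: (ent_impE (A := iter n lift B)); last by apply: ent_hyp => /=; auto.
apply: (ent_impE (A := iter n lift A)); last by apply: ent_hyp => /=; auto.
by apply: ent_weak d _ => D /=; auto.
Qed.

End SentenceTheory.

(** * Arithmetic in extensions of PA *)

Section PA.

Variable T : theory.
Hypothesis sT : forall A, T A -> sentence A.
Hypothesis TPA : extends T PA.

Lemma ent_PA G A : PA A -> ent T G A.
Proof.
move=> pA; apply: ent0; apply: TPA; exists [:: A].
by split=> [B [<-|//]|] //; apply: nd_hyp; left.
Qed.

Lemma ent_S_neq0 G t : ent T G (Eq (Succ t) Zero) -> ent T G Bot.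
Proof. exact: ent_impE (ent_allE t (ent_PA G PA_succ_neq0)). Qed.

Lemma ent_S_inj G t u : ent T G (Eq (Succ t) (Succ u)) -> ent T G (Eq t u).
Proof.
have := ent_allE u (ent_allE t (ent_PA G PA_succ_inj)).
by rewrite /inst /= tsubst_scons_tlift tsubst_var; apply: ent_impE.
Qed.

Lemma ent_add0 G t : ent T G (Eq (Add t Zero) t).
Proof. exact: ent_allE t (ent_PA G PA_add0). Qed.

Lemma ent_addS G t u : ent T G (Eq (Add t (Succ u)) (Succ (Add t u))).
Proof.
have := ent_allE u (ent_allE t (ent_PA G PA_addS)).
by rewrite /inst /= tsubst_scons_tlift tsubst_var.
Qed.

Lemma ent_mul0 G t : ent T G (Eq (Mul t Zero) Zero).
Proof. exact: ent_allE t (ent_PA G PA_mul0). Qed.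

Lemma ent_mulS G t u : ent T G (Eq (Mul t (Succ u)) (Add (Mul t u) t)).
Proof.
have := ent_allE u (ent_allE t (ent_PA G PA_mulS)).
by rewrite /inst /= tsubst_scons_tlift tsubst_var.
Qed.

Lemma ent_leP G t u :
  ent T G (Iff (Le t u) (Ex (Eq (Add (tlift t) (Var 0)) (tlift u)))).
Proof.
have := ent_allE u (ent_allE t (ent_PA G PA_le)).
rewrite /inst /= tsubst_scons_tlift tsubst_var.
by rewrite -[scons (Var 0) _]/(up _) tsubst_up tsubst_scons_tlift tsubst_var.
Qed.

Lemma ent_leI G t u v : ent T G (Eq (Add t v) u) -> ent T G (Le t u).
Proof.
move=> d; apply: ent_impE (ent_andE2 (ent_leP G t u)) _.
apply: (ent_exI (t := v)).
by rewrite /inst /= !tsubst_scons_tlift !tsubst_var.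
Qed.

Lemma ent_leE G t u C : ent T G (Le t u) ->
  ent T (Eq (Add (tlift t) (Var 0)) (tlift u) :: map lift G) (lift C) ->
  ent T G C.
Proof. by move=> /(ent_impE (ent_andE1 (ent_leP G t u))); apply: ent_exE. Qed.

(** Induction as a rule on free variables, with no side hypotheses. The facts on terms below are
    proved at variables and then moved to terms and contexts by [ent_subst] and [ent0]. *)
Lemma ent_ind n A : bounded n.+1 A -> ent T [::] (inst A Zero) ->
  ent T [:: A] (subst (scons (Succ (Var 0)) (fun i => Var i.+1)) A) ->
  ent T [::] A.
Proof.
move=> bA d0 dS; have := ent_allN_E sT (ent_PA [::] (PA_induction bA)).
move=> /ent_impE /(_ d0) /ent_impE.
move=> /(_ (ent_allI sT (G := [::]) (ent_impI dS))) d.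
exact: (ent_allN_E sT (n := 1) d).
Qed.

Lemma ent_zero_or_succ G t :
  ent T G (Or (Eq t Zero) (Ex (Eq (tlift t) (Succ (Var 0))))).
Proof.
have : ent T [::] (Or (Eq (Var 0) Zero) (Ex (Eq (Var 1) (Succ (Var 0))))).
  apply: (@ent_ind 0) => //=; first exact/ent_orI1/ent_refl.
  by apply: ent_orI2; apply: (ent_exI (t := Var 0)); apply: ent_refl.
by move=> /(ent_subst sT (scons t Var)) d; apply: ent0.
Qed.

Lemma ent_add0l G t : ent T G (Eq (Add Zero t) t).
Proof.
have : ent T [::] (Eq (Add Zero (Var 0)) (Var 0)).
  apply: (@ent_ind 0) => //=; first exact: ent_add0.
  exact: ent_trans (ent_addS _ _ _) (ent_eqS (ent_hd _ _ _)).
by move=> /(ent_subst sT (scons t Var)) d; apply: ent0.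
Qed.

Lemma ent_addSl G t u : ent T G (Eq (Add (Succ u) t) (Succ (Add u t))).
Proof.
have : ent T [::] (Eq (Add (Succ (Var 1)) (Var 0)) (Succ (Add (Var 1) (Var 0)))).
  apply: (@ent_ind 1) => //=.
    exact: ent_trans (ent_add0 _ _) (ent_eqS (ent_sym (ent_add0 _ _))).
  apply: ent_trans (ent_addS _ _ _) (ent_eqS _).
  exact: ent_trans (ent_hd _ _ _) (ent_sym (ent_addS _ _ _)).
by move=> /(ent_subst sT (scons t (scons u Var))) d; apply: ent0.
Qed.

Lemma ent_case_nat G t C : ent T (Eq t Zero :: G) C ->
  ent T (Eq (tlift t) (Succ (Var 0)) :: map lift G) (lift C) -> ent T G C.
Proof.
move=> d0 dS; apply: ent_orE (ent_zero_or_succ G t) d0 _.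
apply: ent_exE (ent_hd _ _ _) _ => //.
by apply: ent_weak dS _; apply: cons_sub; right.
Qed.

Definition liftE := ((fun t u => erefl : lift (Eq t u) = Eq (tlift t) (tlift u)),
  (fun t u => erefl : lift (Le t u) = Le (tlift t) (tlift u)),
  (fun A B => erefl : lift (Or A B) = Or (lift A) (lift B))).

(** External induction on [n], with a case distinction on [u] inside the theory: at zero [t] equals
    n, at a successor the sum drops by one. A rule with one derivation per [k] avoids writing the
    finite disjunction. *)
Lemma ent_add_cases n G t u C : ent T G (Eq (Add t u) (numeral n)) ->
  (forall k, k <= n -> ent T (Eq t (numeral k) :: G) C) -> ent T G C.
Proof.
elim: n G t u C => [|n IH] G t u C d dk; apply: (ent_case_nat (t := u)).
- apply: ent_cut (ent_weak (dk 0 isT) _); last first.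
    by apply: cons_sub; right.
  apply: ent_trans (ent_cons _ d).
  apply: ent_trans (ent_sym (ent_add0 _ _)) _.
  exact: ent_eqD (ent_refl _ _ _) (ent_sym (ent_hd _ _ _)).
- apply: ent_bot; apply: (ent_S_neq0 (t := Add (tlift t) (Var 0))).
  apply: ent_trans (ent_sym (ent_addS _ _ _)) _.
  apply: ent_trans (ent_eqD (ent_refl _ _ _) (ent_sym (ent_hd _ _ _))) _.
  exact: ent_cons (ent_subst sT _ d).
- apply: ent_cut (ent_weak (dk n.+1 (leqnn _)) _); last first.
    by apply: cons_sub; right.
  apply: ent_trans (ent_cons _ d).
  apply: ent_trans (ent_sym (ent_add0 _ _)) _.
  exact: ent_eqD (ent_refl _ _ _) (ent_sym (ent_hd _ _ _)).
- apply: (IH _ (tlift t) (Var 0)).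
    apply: ent_S_inj; apply: ent_trans (ent_sym (ent_addS _ _ _)) _.
    apply: ent_trans (ent_eqD (ent_refl _ _ _) (ent_sym (ent_hd _ _ _))) _.
    have := ent_subst sT (fun i => Var i.+1) d.
    by rewrite /= tsubst_numeral => /ent_cons; apply.
  move=> k kn; have := ent_subst sT (fun i => Var i.+1) (dk k (leqW kn)).
  rewrite /= tsubst_numeral => d'; apply: ent_weak d' _.
  by apply: cons_sub; right.
Qed.

Lemma ent_le_cases n G t C : ent T G (Le t (numeral n)) ->
  (forall k, k <= n -> ent T (Eq t (numeral k) :: G) C) -> ent T G C.
Proof.
move=> d dk; apply: ent_leE d _; rewrite tlift_numeral.
apply: ent_add_cases (ent_hd _ _ _) _ => k kn.
have := ent_subst sT (fun i => Var i.+1) (dk k kn).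
rewrite /= tsubst_numeral => d'; apply: ent_weak d' _.
by apply: cons_sub; right.
Qed.

Lemma ent_le_total n G t : ent T G (Or (Le t (numeral n)) (Le (numeral n) t)).
Proof.
elim: n => [|n IH].
  by apply: ent_orI2; apply: ent_leI (ent_add0l _ _).
apply: ent_orE IH _ _.
  apply: ent_orI1; apply: ent_leE (ent_hd _ _ _) _.
  rewrite !liftE (tlift_numeral n.+1) tlift_numeral.
  apply: (ent_leI (v := Succ (Var 0))).
  exact: ent_trans (ent_addS _ _ _) (ent_eqS (ent_hd _ _ _)).
apply: ent_leE (ent_hd _ _ _) _; rewrite !liftE !tlift_numeral.
(* [Var 0] is the difference of [t] and n. If it is zero, [t] equals n and lies below n + 1;
   otherwise its predecessor witnesses that n + 1 is at most [t]. *)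
apply: (ent_case_nat (t := Var 0)).
  apply: ent_orI1; apply: (ent_leI (v := Succ Zero)).
  apply: ent_trans (ent_addS _ _ _) (ent_eqS _).
  apply: ent_trans (ent_add0 _ _) _.
  apply: ent_trans (ent_sym (ent_cons _ (ent_hd _ _ _))) _.
  apply: ent_trans (ent_eqD (ent_refl _ _ _) (ent_hd _ _ _)) _.
  exact: ent_add0.
rewrite !liftE tlift_numeral; apply: ent_orI2; apply: (ent_leI (v := Var 0)).
apply: ent_trans (ent_addSl _ _ _) _.
apply: ent_trans (ent_sym (ent_addS _ _ _)) _.
apply: ent_trans (ent_eqD (ent_refl _ _ _) (ent_sym (ent_hd _ _ _))) _.
by apply: ent_hyp; right; left; rewrite liftE /tlift /= tsubst_numeral.
Qed.

Lemma ent_addn G m n :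
  ent T G (Eq (Add (numeral m) (numeral n)) (numeral (m + n))).
Proof.
elim: n => [|n IH]; first by rewrite addn0; apply: ent_add0.
by rewrite addnS; apply: ent_trans (ent_addS _ _ _) (ent_eqS IH).
Qed.

Lemma ent_muln G m n :
  ent T G (Eq (Mul (numeral m) (numeral n)) (numeral (m * n))).
Proof.
elim: n => [|n IH]; first by rewrite muln0; apply: ent_mul0.
rewrite mulnS addnC; apply: ent_trans (ent_mulS _ _ _) _.
exact: ent_trans (ent_eqD IH (ent_refl _ _ _)) (ent_addn _ _ _).
Qed.

Lemma ent_addn_eq G t u m n : ent T G (Eq t (numeral m)) ->
  ent T G (Eq u (numeral n)) -> ent T G (Eq (Add t u) (numeral (m + n))).
Proof. by move=> dt du; apply: ent_trans (ent_eqD dt du) (ent_addn _ _ _). Qed.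

Lemma ent_muln_eq G t u m n : ent T G (Eq t (numeral m)) ->
  ent T G (Eq u (numeral n)) -> ent T G (Eq (Mul t u) (numeral (m * n))).
Proof. by move=> dt du; apply: ent_trans (ent_eqM dt du) (ent_muln _ _ _). Qed.

Lemma ent_tpair G t u m n : ent T G (Eq t (numeral m)) ->
  ent T G (Eq u (numeral n)) -> ent T G (Eq (tpair t u) (numeral (pairn m n))).
Proof.
move=> dt du; apply: (ent_addn_eq _ dt).
by apply: ent_muln_eq; apply: ent_addn_eq.
Qed.

Lemma ent_neqn G m n : m != n ->
  ent T G (Eq (numeral m) (numeral n)) -> ent T G Bot.
Proof.
elim: m n => [|m IH] [|n] //= mn d.
- exact: ent_S_neq0 (ent_sym d).
- exact: ent_S_neq0 d.
- exact: IH n mn (ent_S_inj d).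
Qed.

Lemma ent_len G m n : m <= n -> ent T G (Le (numeral m) (numeral n)).
Proof.
move=> mn; apply: (ent_leI (v := numeral (n - m))).
by have := ent_addn G m (n - m); rewrite subnKC.
Qed.

Lemma ent_nlen G m n : n < m ->
  ent T G (Le (numeral m) (numeral n)) -> ent T G Bot.
Proof.
move=> nm d; apply: ent_le_cases d _ => k kn.
by apply: ent_neqn (ent_hd _ _ _); rewrite neq_ltn (leq_ltn_trans kn nm) orbT.
Qed.

(** * Truth in the standard model decides [Delta0] sentences *)

Fixpoint teval (v : nat -> nat) (t : term) : nat :=
  match t with
  | Var i => v i
  | Zero => 0
  | Succ t => (teval v t).+1
  | Add t u => teval v t + teval v u
  | Mul t u => teval v t * teval v u
  end.

Definition vcons (n : nat) (v : nat -> nat) (i : nat) : nat :=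
  if i is j.+1 then v j else n.

Fixpoint sat (v : nat -> nat) (A : formula) : Prop :=
  match A with
  | Bot => False
  | Eq t u => teval v t = teval v u
  | Le t u => teval v t <= teval v u
  | Imp A B => sat v A -> sat v B
  | And A B => sat v A /\ sat v B
  | Or A B => sat v A \/ sat v B
  | All A => forall n, sat (vcons n v) A
  | Ex A => exists n, sat (vcons n v) A
  end.

Lemma teval_tlift n v t : teval (vcons n v) (tlift t) = teval v t.
Proof. by elim: t => //= [t ->|t -> u ->|t -> u ->]. Qed.

Definition num_subst (v : nat -> nat) (i : nat) : term := numeral (v i).

Lemma ent_teval G v t :
  ent T G (Eq (tsubst (num_subst v) t) (numeral (teval v t))).
Proof.
elim: t => /= [i||t IH|t IHt u IHu|t IHt u IHu].
- exact: ent_refl.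
- exact: ent_refl.
- exact: ent_eqS.
- exact: ent_addn_eq.
- exact: ent_muln_eq.
Qed.

Lemma inst_num_subst v A k :
  inst (subst (up (num_subst v)) A) (numeral k) = subst (num_subst (vcons k v)) A.
Proof.
rewrite /inst subst_subst; apply: eq_subst => -[|i] //=.
by rewrite tsubst_scons_tlift tsubst_numeral.
Qed.

(** Combined with [ent_le_cases], this breaks a bounded quantifier into finitely many numeral
    instances. *)
Lemma ent_inst_eq G A k : ent T G (Eq (Var 0) (numeral k)) ->
  ent T [::] (inst A (numeral k)) -> ent T G A.
Proof.
move=> e d; rewrite -[A]inst_up_lift; apply: ent_eq (ent_sym e) _.
have := ent_subst sT (fun i => Var i.+1) d.
by rewrite subst_inst tsubst_numeral => /ent0; apply.
Qed.

(* The two halves need each other at [Imp]. *)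
Lemma Delta0_decided A : Delta0 A -> forall v,
  (sat v A -> ent T [::] (subst (num_subst v) A)) /\
  (~ sat v A -> ent T [:: subst (num_subst v) A] Bot).
Proof.
elim=> {A} [|t u|t u|A B _ IA _ IB|A B _ IA _ IB|A B _ IA _ IB|t A _ IA|t A _ IA]
  v.
- by split=> //= _; apply: ent_hd.
- split=> /= [e|/eqP ne].
    by apply: ent_trans (ent_teval _ _ _) _; rewrite e; apply/ent_sym/ent_teval.
  apply: ent_neqn ne _; apply: ent_trans (ent_sym (ent_teval _ _ _)) _.
  exact: ent_trans (ent_hd _ _ _) (ent_teval _ _ _).
- split=> /= [le|/negP nle].
    by apply: ent_le (ent_len _ le); apply/ent_sym/ent_teval.
  rewrite -ltnNge in nle; apply: ent_nlen nle _.
  by apply: ent_le (ent_hd _ _ _); apply: ent_teval.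
- have [pA nA] := IA v; have [pB nB] := IB v; split=> /=.
    move=> AB; apply: ent_impI; case: (classic (sat v A)) => [/AB/pB|/nA].
      exact: ent0.
    exact: ent_bot.
  move=> h; have [/pA dA /nB dB] := imply_to_and _ _ h.
  apply: ent_cut (ent_weak dB _); first exact: ent_impE (ent_hd _ _ _) (ent0 _ dA).
  by move=> D [<-|//]; left.
- have [pA nA] := IA v; have [pB nB] := IB v; split=> /=.
    by move=> [/pA dA /pB dB]; apply: ent_andI.
  move=> h; case: (not_and_or _ _ h) => [/nA|/nB] d; apply: ent_cut (ent_weak d _).
  + exact: ent_andE1 (ent_hd _ _ _).
  + by move=> D [<-|//]; left.
  + exact: ent_andE2 (ent_hd _ _ _).
  + by move=> D [<-|//]; left.
- have [pA nA] := IA v; have [pB nB] := IB v; split=> /=.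
    by move=> [/pA dA|/pB dB]; [apply: ent_orI1|apply: ent_orI2].
  move=> h; have [/nA dA /nB dB] := not_or_and _ _ h.
  apply: ent_orE (ent_hd _ _ _) (ent_weak dA _) (ent_weak dB _).
  + by move=> D [<-|//]; left.
  + by move=> D [<-|//]; left.
- rewrite subst_AllLe; split=> [/= h|].
    apply: ent_allI => //; apply: ent_impI.
    apply: (@ent_le_cases (teval v t) _ (Var 0)).
      apply: ent_le (ent_refl _ _ _) _ (ent_hd _ _ _).
      have := ent_subst sT (fun i => Var i.+1) (ent_teval [::] v t).
      by rewrite /= tsubst_numeral => /ent0; apply.
    move=> k kn; apply: ent_inst_eq (ent_hd _ _ _) _; rewrite inst_num_subst.
    by apply: (IA _).1; apply: h; rewrite teval_tlift.
  move=> h; have [k hk] := not_all_ex_not _ _ h.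
  have [kn /(IA _).2 d] := imply_to_and _ _ hk.
  have := ent_allE (numeral k) (ent_hd T [::] (AllLe (tsubst (num_subst v) t)
    (subst (up (num_subst v)) A))).
  rewrite /inst /= tsubst_scons_tlift tsubst_var => /ent_impE d'.
  apply: ent_cut (d' _) _.
    apply: ent_le (ent_refl _ _ _) (ent_sym (ent_teval _ _ _)) (ent_len _ _).
    by rewrite /= teval_tlift in kn.
  rewrite -[subst _ (subst _ _)]/(inst _ _) inst_num_subst.
  by apply: ent_weak d _ => D [<-|//]; left.
- rewrite subst_ExLe; split=> [/= [k [kn /(IA _).1 d]]|nh].
    apply: (ent_exI (t := numeral k)).
    rewrite /inst /= tsubst_scons_tlift tsubst_var; apply: ent_andI.
      apply: ent_le (ent_refl _ _ _) (ent_sym (ent_teval _ _ _)) (ent_len _ _).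
      by rewrite teval_tlift in kn.
    by rewrite -[subst _ (subst _ _)]/(inst _ _) inst_num_subst.
  apply: ent_exE (ent_hd _ _ _) _ => //.
  apply: (@ent_le_cases (teval v t) _ (Var 0)).
    apply: ent_le (ent_refl _ _ _) _ (ent_andE1 (ent_hd _ _ _)).
    have := ent_subst sT (fun i => Var i.+1) (ent_teval [::] v t).
    by rewrite /= tsubst_numeral => /ent0; apply.
  (* The body of the quantifier is moved from the hypotheses into the goal, the only place where
     [ent_inst_eq] replaces the variable. *)
  move=> k kn; apply: (ent_impE (A := subst (up (num_subst v)) A)); last first.
    exact: ent_andE2 (ent_cons _ (ent_hd _ _ _)).
  apply: ent_inst_eq (ent_hd _ _ _) _; rewrite /inst /=.
  rewrite -[subst _ (subst _ _)]/(inst _ _) inst_num_subst.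
  apply: ent_impI; apply: (IA _).2 => h; apply: nh; exists k; split=> //=.
  by rewrite teval_tlift.
Qed.

End PA.

(** * The graph of the numeral function in the standard model *)

Lemma chinese_seq (m r : nat -> nat) n :
  (forall i j, i < j < n -> coprime (m j) (m i)) ->
  exists a, forall i, i < n -> a = r i %[mod m i].
Proof.
(* [P] plays the product of the moduli so far. Being a multiple of each, and coprime to whatever is
   coprime to all of them, is what the next use of the two-modulus [chinese] requires. *)
move=> co; suff [a [P [aP _ _]]] : exists a P,
  [/\ forall i, i < n -> a = r i %[mod m i], forall i, i < n -> m i %| P
    & forall d, (forall i, i < n -> coprime d (m i)) -> coprime d P].
  by exists a.
elim: n co => [|n IH] co; first by exists 0, 1; split=> // d _; apply: coprimen1.
have [i j /andP[ij jn]|a [P [aP dP cP]]] := IH.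
  by apply: co; rewrite ij ltnW.
have coPn : coprime P (m n).
  by rewrite coprime_sym; apply: cP => i lin; apply: co; rewrite lin leqnn.
exists (chinese P (m n) a (r n)), (P * m n); split=> [i|i|d cd].
- rewrite ltnS leq_eqVlt => /predU1P[->|lin]; first exact: chinese_modr.
  have := chinese_modl coPn a (r n).
  move=> /(congr1 (modn^~ (m i))); rewrite !modn_dvdm ?dP // => ->.
  exact: aP.
- rewrite ltnS leq_eqVlt => /predU1P[->|lin]; first exact: dvdn_mull.
  exact/dvdn_mulr/dP.
- by rewrite coprimeMr cd // cP // => i lin; apply: cd; apply: leqW.
Qed.

Lemma beta_seq (r : nat -> nat) n :
  exists a b, forall i, i <= n -> a %% (i.+1 * b).+1 = r i.
Proof.
(* [M] is at least n, so that every positive difference of indices divides [b], and at least every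
   entry, so that each entry is smaller than its modulus. *)
pose M := n + \max_(i < n.+1) r i; pose b := M`!.
have [i j /andP[ij jn]|a aP] := @chinese_seq (fun i => (i.+1 * b).+1) r n.+1.
  (* A common divisor divides j - i, hence the factorial [b], hence 1. *)
  set d := gcdn (j.+1 * b).+1 (i.+1 * b).+1; rewrite /coprime -/d -dvdn1.
  have di : d %| (i.+1 * b).+1 by apply: dvdn_gcdr.
  have dj : d %| (j.+1 * b).+1 by apply: dvdn_gcdl.
  have dji : d %| j - i.
    have -> : j - i = j.+1 * (i.+1 * b).+1 - i.+1 * (j.+1 * b).+1.
      rewrite !mulnS !mulnA [j.+1 * i.+1]mulnC subnDr; lia.
    by apply: dvdn_sub; apply: dvdn_mull.
  have db : d %| b by apply: dvdn_trans dji (dvdn_fact _); rewrite /M; lia.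
  by rewrite -(dvdn_addr 1 (dvdn_mull i.+1 db)) addn1.
exists a, b => i ilen; rewrite (aP i) // modn_small // ltnS.
apply: leq_trans (leq_pmull _ _) => //; apply: leq_trans (fact_geq _).
apply: leq_trans (leq_addl _ _).
by have := leq_bigmax (F := fun i : 'I_n.+1 => r i) (Ordinal (ilen : i < n.+1)).
Qed.

Lemma sat_AllLe v t A :
  sat v (AllLe t A) <-> forall k, k <= teval v t -> sat (vcons k v) A.
Proof.
by rewrite /AllLe /=; split=> h k; have := h k; rewrite teval_tlift.
Qed.

Lemma sat_ExLe v t A :
  sat v (ExLe t A) <-> exists2 k, k <= teval v t & sat (vcons k v) A.
Proof.
rewrite /ExLe /=; split=> [[k []]|[k]]; exists k => //.
  by rewrite -(teval_tlift k).
by rewrite teval_tlift.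
Qed.

Lemma teval_tsubst v s t : teval v (tsubst s t) = teval (fun i => teval v (s i)) t.
Proof. by elim: t => //= [t ->|t -> u ->|t -> u ->]. Qed.

Lemma eq_teval v w t : v =1 w -> teval v t = teval w t.
Proof. by move=> e; elim: t => //= [t ->|t -> u ->|t -> u ->]. Qed.

Lemma eq_sat v w A : v =1 w -> sat v A <-> sat w A.
Proof.
have eqc n p q : p =1 q -> vcons n p =1 vcons n q by move=> e [].
elim: A v w => //= [t u|t u|A IA B IB|A IA B IB|A IA B IB|A IA|A IA] v w e.
- by rewrite !(eq_teval _ e).
- by rewrite !(eq_teval _ e).
- by rewrite (IA _ _ e) (IB _ _ e).
- by rewrite (IA _ _ e) (IB _ _ e).
- by rewrite (IA _ _ e) (IB _ _ e).
- by split=> h n; apply/(IA _ _ (eqc n _ _ e)).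
- by split=> -[n h]; exists n; apply/(IA _ _ (eqc n _ _ e)).
Qed.

Lemma sat_subst v s A : sat v (subst s A) <-> sat (fun i => teval v (s i)) A.
Proof.
have eqc n p r : (fun i => teval (vcons n p) (up r i))
    =1 vcons n (fun i => teval p (r i)) by case=> //= i; rewrite teval_tlift.
elim: A v s => //= [t u|t u|A IA B IB|A IA B IB|A IA B IB|A IA|A IA] v s.
- by rewrite !teval_tsubst.
- by rewrite !teval_tsubst.
- by rewrite IA IB.
- by rewrite IA IB.
- by rewrite IA IB.
- by split=> h n; have := h n; rewrite IA => /(eq_sat _ (eqc _ _ _)).
- by split=> -[n h]; exists n; move: h; rewrite IA => /(eq_sat _ (eqc _ _ _)).
Qed.

Lemma teval_numeral v n : teval v (numeral n) = n.
Proof. by elim: n => //= n ->. Qed.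

Lemma sat_And v A B : sat v (And A B) = (sat v A /\ sat v B).
Proof. by []. Qed.

Lemma sat_Imp v A B : sat v (Imp A B) = (sat v A -> sat v B).
Proof. by []. Qed.

Lemma sat_beta v a b i r : sat v (beta a b i r) <->
  teval v a %% ((teval v i).+1 * teval v b).+1 = teval v r.
Proof.
rewrite /beta /= -/(sat v (ExLe _ _)); split.
  move=> [le_r [q []]]; rewrite !teval_tlift => _ ->.
  by rewrite modnMDl modn_small.
move=> e; split; first by rewrite -e -ltnS ltn_mod.
exists (teval v a %/ ((teval v i).+1 * teval v b).+1).
rewrite !teval_tlift leq_div; split=> //.
by rewrite -e -divn_eq.
Qed.

(* The matrix of [num_graph], with the sequence coded by [Var 1] and [Var 0],
   the argument [Var 2] and the value [Var 3]. *)
Definition num_seq : formula :=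
  And (beta (Var 1) (Var 0) Zero (numeral (tgn Zero)))
 (And (AllLe (Var 2) (Imp (Le (Succ (Var 0)) (Var 3))
         (ExLe (Var 2)
           (And (beta (Var 3) (Var 2) (Var 1) (Var 0))
                (beta (Var 3) (Var 2) (Succ (Var 1)) (tpair (numeral 2) (Var 0)))))))
      (beta (Var 1) (Var 0) (Var 2) (Var 3))).

(* [Var 1] is the code of the numeral of [Var 0], as witnessed below [Var 2]. *)
Definition num_wit : formula := ExLe (Var 2) (ExLe (Var 3) num_seq).

Lemma Delta0_num_wit : Delta0 num_wit.
Proof. by do !constructor. Qed.

Lemma sat_num_seq v : sat v num_seq <->
  let e i := v 1 %% (i.+1 * v 0).+1 in
  [/\ e 0 = tgn Zero, forall i, i < v 2 -> e i.+1 = pairn 2 (e i) & e (v 2) = v 3].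
Proof.
rewrite /num_seq !sat_And.
split=> [[/sat_beta e0 [/sat_AllLe es /sat_beta en]]|[e0 es en]].
  rewrite teval_numeral in e0; split=> // i iv.
  have := es i (ltnW iv); rewrite sat_Imp => /(_ iv) /sat_ExLe [r _].
  by rewrite sat_And !sat_beta => -[/= -> ->].
split; first by apply/sat_beta; rewrite teval_numeral.
split; last exact/sat_beta.
apply/sat_AllLe => i _; rewrite sat_Imp => iv; apply/sat_ExLe.
(* The current entry is a remainder of the code [v 1], hence within the bound on the inner
   quantifier. *)
exists (v 1 %% (i.+1 * v 0).+1); first exact: leq_mod.
by rewrite sat_And; split; apply/sat_beta => //=; rewrite es.
Qed.

Lemma num_seqP (e : nat -> nat) n : e 0 = tgn Zero ->
  (forall i, i < n -> e i.+1 = pairn 2 (e i)) -> e n = tgn (numeral n).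
Proof.
move=> e0; elim: n => // n IH es; rewrite es // IH // => i lin.
by apply: es; apply: leqW.
Qed.

Lemma num_wit_sound v : sat v num_wit -> v 1 = tgn (numeral (v 0)).
Proof.
move=> /sat_ExLe [a _ /sat_ExLe [b _ /sat_num_seq /= [e0 es <-]]].
exact: (num_seqP (e := fun i => a %% (i.+1 * b).+1)).
Qed.

Definition env3 (x u c : nat) (v : nat -> nat) := vcons x (vcons u (vcons c v)).

(** A single bound must dominate both beta parameters, and also the value, which [num_rosser] wants
    below its witness; the sum of the three does. *)
Lemma num_wit_complete x : exists2 c, tgn (numeral x) <= c &
  forall v, sat (env3 x (tgn (numeral x)) c v) num_wit.
Proof.
have [a [b ab]] := beta_seq (fun i => tgn (numeral i)) x.
exists (tgn (numeral x) + a + b) => [|v]; first by rewrite -addnA leq_addr.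
apply/sat_ExLe; exists a; first by rewrite /= addnAC leq_addl.
apply/sat_ExLe; exists b; first exact: leq_addl.
apply/sat_num_seq; split=> /= [|i ix|]; rewrite ?ab //.
exact: ltnW.
Qed.

(** * Diagonalization *)

Definition substE := (
  (fun s t u => erefl : subst s (Eq t u) = Eq (tsubst s t) (tsubst s u)),
  (fun s t u => erefl : subst s (Le t u) = Le (tsubst s t) (tsubst s u)),
  (fun s A B => erefl : subst s (And A B) = And (subst s A) (subst s B)),
  (fun s A B => erefl : subst s (Imp A B) = Imp (subst s A) (subst s B))).

(** * A bounded and provably single-valued definition of the code of a numeral *)

Definition num_wit_at (x u c : term) : formula :=
  subst (scons x (scons u (scons c Var))) num_wit.

Lemma bounded_num_wit : bounded 3 num_wit.
Proof. by []. Qed.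

Lemma subst_num_wit_at s x u c :
  subst s (num_wit_at x u c) = num_wit_at (tsubst s x) (tsubst s u) (tsubst s c).
Proof.
rewrite /num_wit_at subst_subst.
by apply: eq_subst_bounded bounded_num_wit _ => -[|[|[]]].
Qed.

Lemma num_wit_at_numeral x u c :
  num_wit_at (numeral x) (numeral u) (numeral c) =
  subst (num_subst (env3 x u c (fun=> 0))) num_wit.
Proof. by apply: eq_subst_bounded bounded_num_wit _ => -[|[|[]]]. Qed.

(* In the manner of Rosser, no rival value has a witness below [w]: this makes
   the uniqueness of [u] a matter of deciding finitely many Delta0 sentences,
   without proving in PA that remainders are unique. *)
Definition num_rosser (x u w : term) : formula :=
  And (Le u w)
 (And (num_wit_at x u w)
      (AllLe w (AllLe (tlift w)
        (Imp (num_wit_at (tlift (tlift x)) (Var 0) (Var 1))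
             (Eq (Var 0) (tlift (tlift u))))))).

Lemma subst_num_rosser s x u w :
  subst s (num_rosser x u w) =
  num_rosser (tsubst s x) (tsubst s u) (tsubst s w).
Proof.
by rewrite /num_rosser !(substE, subst_AllLe, subst_num_wit_at, tsubst_up).
Qed.

Lemma Delta0_num_rosser x u w : Delta0 (num_rosser x u w).
Proof. by do !constructor; apply: Delta0_subst Delta0_num_wit. Qed.

Section Rosser.

Variable T : theory.
Hypothesis sT : forall A, T A -> sentence A.
Hypothesis TPA : extends T PA.

Lemma ent_AllLeE G A t u :
  ent T G (AllLe t A) -> ent T G (Le u t) -> ent T G (inst A u).
Proof.
move=> /(ent_allE u); rewrite /inst /= tsubst_scons_tlift tsubst_var.
exact: ent_impE.
Qed.

Lemma ent_num_wit G x u c : sat (env3 x u c (fun=> 0)) num_wit ->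
  ent T G (num_wit_at (numeral x) (numeral u) (numeral c)).
Proof.
move=> h; rewrite num_wit_at_numeral; apply: ent0.
exact: (Delta0_decided sT TPA Delta0_num_wit _).1.
Qed.

(** All arguments are numerals, so the hypothesis is decided: if true, soundness makes the two sides
    the same numeral; if false, it is refutable. *)
Lemma ent_num_wit_inv G x u c :
  ent T G (num_wit_at (numeral x) (numeral u) (numeral c)) ->
  ent T G (Eq (numeral u) (numeral (tgn (numeral x)))).
Proof.
case: (classic (sat (env3 x u c (fun=> 0)) num_wit)) => [/num_wit_sound /= ->|h] d.
  exact: ent_refl.
apply: ent_bot; apply: ent_cut d _; rewrite num_wit_at_numeral.
apply: ent_weak ((Delta0_decided sT TPA Delta0_num_wit _).2 h) _.
by move=> D [<-|//]; left.
Qed.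

(** In the standard model soundness leaves no rival value, so the Rosser clause is true, and true
    [Delta0] sentences are provable. *)
Lemma num_rosser_exists x : exists w,
  ent T [::] (num_rosser (numeral x) (numeral (tgn (numeral x))) (numeral w)).
Proof.
have [w uw xw] := num_wit_complete x; exists w.
pose v := env3 x (tgn (numeral x)) w (fun=> 0).
have := (Delta0_decided sT TPA (Delta0_num_rosser (Var 0) (Var 1) (Var 2)) v).1.
rewrite subst_num_rosser; apply; rewrite /num_rosser !sat_And; split=> //.
split.
  by apply/sat_subst; apply: (iffLR (eq_sat _ _)) (xw v) => -[|[|[]]].
apply/sat_AllLe => w' _; apply/sat_AllLe => u' _.
by rewrite sat_Imp => /sat_subst /num_wit_sound.
Qed.

(** Only [x] is standard; [u] and [w] are any terms. They are measured against a true witness [c]: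
    for [w] below [c] finitely many numeral cases remain, and for [w] above [c] the Rosser clause
    compares [u] with the true value. *)
Lemma num_rosser_unique G x u w : ent T G (num_rosser (numeral x) u w) ->
  ent T G (Eq u (numeral (tgn (numeral x)))).
Proof.
move=> d; have du := ent_andE1 d; have dW := ent_andE1 (ent_andE2 d).
have dR := ent_andE2 (ent_andE2 d).
have [c uc xc] := num_wit_complete x; set f := tgn _ in uc xc *.
(* Below a numeral, [w] and then [u] run through numerals, where [ent_num_wit_inv] applies. *)
have small n : ent T (Le w (numeral n) :: G) (Eq u (numeral f)).
  apply: ent_le_cases (ent_hd _ _ _) _ => // k kn.
  apply: (@ent_le_cases T sT TPA k _ u).
    by apply: ent_le (ent_refl _ _ _) (ent_hd _ _ _) (ent_cons _ (ent_cons _ du)).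
  move=> j jk; apply: ent_trans (ent_hd _ _ _) _.
  apply: (@ent_num_wit_inv _ x j k).
  have := @ent_eq T (Eq u (numeral j) :: Eq w (numeral k) :: Le w (numeral n) :: G)
    (num_wit_at (numeral x) (Var 0) (tlift w)) u (numeral j) (ent_hd _ _ _).
  rewrite /inst !subst_num_wit_at /= !tsubst_scons_tlift !tsubst_var !tsubst_numeral.
  move=> /(_ (ent_cons _ (ent_cons _ (ent_cons _ dW)))) d1.
  have := @ent_eq T (Eq u (numeral j) :: Eq w (numeral k) :: Le w (numeral n) :: G)
    (num_wit_at (numeral x) (numeral j) (Var 0)) w (numeral k)
    (ent_cons _ (ent_hd _ _ _)).
  by rewrite /inst !subst_num_wit_at /= !tsubst_numeral; apply.
apply: ent_orE (ent_le_total sT TPA c G w) (small c) _.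
(* The bound of [f] by [w] comes from a second comparison instead of transitivity; the opposite
   outcome is settled by [small]. *)
apply: ent_orE (ent_cons _ (ent_le_total sT TPA f G w)) _ _.
  by apply: ent_weak (small f) _; apply: cons_sub; right.
set G' := _ :: _; have {}dR : ent T G' _ := ent_cons _ (ent_cons _ dR).
(* The Rosser clause is taken at the witness [c], then at the value [f]. *)
have := ent_AllLeE dR (ent_cons _ (ent_hd _ _ _)).
rewrite /inst subst_AllLe tsubst_scons_tlift tsubst_var.
move=> /ent_AllLeE /(_ (ent_hd _ _ _)).
rewrite /inst !(substE, subst_num_wit_at, tsubst_up, tsubst_scons_tlift, tsubst_var).
by move=> /ent_impE /(_ (ent_num_wit _ (xc (fun=> 0)))) /ent_sym.
Qed.

End Rosser.

(** * The diagonal sentence *)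

(** Follows [gn] through n + 3 universal quantifiers (tag 6) and an implication (tag 3) whose
    premise is an equation (tag 1) between [Var (n + 2)] and a term of code [u], and whose
    conclusion has code [x]. *)
Definition diag_code (n : nat) (x u : term) : term :=
  iter n.+3 (tpair (numeral 6)) (tpair (numeral 3)
    (tpair (tpair (numeral 1) (tpair (numeral (tgn (Var (n + 2)))) u)) x)).

Lemma tsubst_diag_code s n x u :
  tsubst s (diag_code n x u) = diag_code n (tsubst s x) (tsubst s u).
Proof.
have E m t : tsubst s (iter m (tpair (numeral 6)) t) =
    iter m (tpair (numeral 6)) (tsubst s t).
  by elim: m => //= m <-.
by rewrite /diag_code E /tpair; cbn [tsubst]; rewrite !tsubst_numeral.
Qed.

Lemma subst_inst1 s A t : bounded 1 A -> subst s (inst A t) = inst A (tsubst s t).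
Proof.
by move=> bA; rewrite /inst subst_subst; apply: eq_subst_bounded bA _ => -[].
Qed.

Lemma tbounded_tpair k t u :
  tbounded k (tpair t u) = tbounded k t && tbounded k u.
Proof. by rewrite /=; case: tbounded; case: tbounded. Qed.

Lemma gn_AllN n A : gn (AllN n A) = iter n (pairn 6) (gn A).
Proof. by elim: n => //= n ->. Qed.

Lemma iter_lift_Eq_Var n t i :
  iter n lift (Eq (Var i) (numeral t)) = Eq (Var (n + i)) (numeral t).
Proof. by elim: n => //= n ->; rewrite liftE /= tlift_numeral. Qed.

Lemma Delta0_iter_lift n A : Delta0 A -> Delta0 (iter n lift A).
Proof. by move=> dA; elim: n => //= n; apply: Delta0_subst. Qed.

Section Diagonal.

Variables (n : nat) (B : formula).
Hypothesis bB : bounded n.+1 B.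

(** Indices 0 to n - 1 are the block of [Pr]; w, u and x sit at n, n + 1 and n + 2. The variable x
    is meant to hold the code of this very formula, a value imposed by the premise of
    [diag_matrix]. *)
Definition diag_body : formula :=
  Imp (iter n lift (num_rosser (Var 2) (Var 1) (Var 0)))
    (Neg (subst (iter n up (scons (diag_code n (Var 2) (Var 1)) Var)) B)).

(* Smullyan's trick: prefixing [x = numeral g] rather than substituting the
   numeral of [g] makes the code of the result a polynomial in [g] and the code
   of that numeral. *)
Definition diag_matrix : formula :=
  Imp (Eq (Var (n + 2)) (numeral (gn diag_body))) diag_body.

Definition diag_sentence : formula := AllN n.+3 diag_matrix.

Lemma Delta0_diag_matrix : Delta0 B -> Delta0 diag_matrix.
Proof.
move=> dB; do 2?constructor; first exact/Delta0_iter_lift/Delta0_num_rosser.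
by constructor; [apply: Delta0_subst|constructor].
Qed.

Lemma bounded_diag_matrix : bounded n.+3 diag_matrix.
Proof.
rewrite /= -addn3 tbounded_numeral ltn_add2l bounded_iter_lift //=.
rewrite andbT; apply: (bounded_subst (k := n + 1)); first by rewrite addn1.
apply: tbounded_iter_up => -[|//] _.
rewrite /diag_code /scons; elim: (X in iter X) => [|k IH].
  by rewrite !(tbounded_tpair, tbounded_numeral).
by rewrite iterS tbounded_tpair IH tbounded_numeral.
Qed.

Variable T : theory.
Hypothesis sT : forall A, T A -> sentence A.
Hypothesis TPA : extends T PA.

Let Pr := ExN n B.

(** The same content with the block of [Pr] back inside the negation, so that [inst Pr] becomes
    visible. *)
Definition diag_spec : formula :=
  Imp (Eq (Var 2) (numeral (gn diag_body)))
 (Imp (num_rosser (Var 2) (Var 1) (Var 0))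
      (Neg (inst Pr (diag_code n (Var 2) (Var 1))))).

Lemma ent_diag_spec G :
  ent T G diag_sentence <-> ent T G (AllN 3 diag_spec).
Proof.
have spec H : ent T H (AllN n diag_matrix) <-> ent T H diag_spec.
  by rewrite /diag_spec /inst /Pr subst_ExN -ent_prenex // iter_lift_Eq_Var.
have -> : diag_sentence = AllN 3 (AllN n diag_matrix) by [].
by split=> /(ent_allN_E sT) /spec d; apply: ent_allN_I.
Qed.

Lemma ent_diag_code G x u :
  ent T G (Eq x (numeral (gn diag_body))) ->
  ent T G (Eq u (numeral (tgn (numeral (gn diag_body))))) ->
  ent T G (Eq (diag_code n x u) (quote diag_sentence)).
Proof.
move=> dx du; rewrite /quote gn_AllN /diag_code.
(* Only the number of outer quantifiers is generalized; the base case is the code of the matrix. *)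
elim: n.+3 => [|k IH]; last exact: ent_tpair (ent_refl _ _ _) IH.
apply: ent_tpair (ent_refl _ _ _) _ => //; apply: ent_tpair dx => //.
apply: ent_tpair (ent_refl _ _ _) _ => //.
exact: ent_tpair (ent_refl _ _ _) du.
Qed.

Lemma ent_allN3_E G A x u w : ent T G (AllN 3 A) ->
  ent T G (subst (scons w (scons u (scons x Var))) A).
Proof.
move=> /(ent_allN_E sT) /(ent_subst sT (scons w (scons u (scons x Var)))).
rewrite -map_comp (eq_map (g := id)) ?map_id // => D /=.
by rewrite /lift !subst_subst -[RHS]subst_var; apply: eq_subst.
Qed.

(** Existence is enough in this direction: the prefix is instantiated at the code of the body, the
    true code of its numeral, and one Rosser witness. *)
Lemma ent_diag_elim G : ent T G diag_sentence ->
  ent T G (inst Pr (quote diag_sentence)) -> ent T G Bot.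
Proof.
move=> /ent_diag_spec d dPr; set g := gn diag_body.
have [w dw] := num_rosser_exists sT TPA g.
have := ent_allN3_E (numeral g) (numeral (tgn (numeral g))) (numeral w) d.
rewrite /diag_spec !(subst_num_rosser, substE).
rewrite subst_inst1 ?bounded_ExN ?addn1 // tsubst_diag_code.
rewrite tsubst_numeral => /ent_impE /(_ (ent_refl _ _ _)).
move=> /ent_impE /(_ (ent0 _ dw)) /ent_impE; apply.
apply: ent_eq dPr; apply/ent_sym/ent_diag_code; exact: ent_refl.
Qed.

(** Here u and w are eigenvariables, so uniqueness is what identifies the value of [diag_code] with
    the quoted sentence. *)
Lemma ent_diag_intro G : ent T G (Neg (inst Pr (quote diag_sentence))) ->
  ent T G diag_sentence.
Proof.
move=> d; apply/ent_diag_spec; apply: ent_allN_I => //.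
have := ent_iter_lift sT 3 d; rewrite !iter_lift_Imp iter_lift_Bot.
(* [Pr] at a numeral is closed, so the shifts past the prefix vanish. *)
have -> m t : iter m lift (inst Pr (numeral t)) = inst Pr (numeral t).
  elim: m => //= m ->.
  by rewrite /lift subst_inst1 ?bounded_ExN ?addn1 // tsubst_numeral.
move=> {}d; do 3!apply: ent_impI; set G' := _ :: _.
have dx : ent T G' (Eq (Var 2) (numeral (gn diag_body))).
  by apply: ent_hyp; right; right; left.
have du : ent T G' (Eq (Var 1) (numeral (tgn (numeral (gn diag_body))))).
  apply: (num_rosser_unique sT TPA (w := Var 0)).
  (* The variable x is first replaced by its numeral, since [num_rosser_unique] is available for
     standard x only. *)
  have := ent_eq (A := num_rosser (Var 0) (Var 2) (Var 1)) dx.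
  rewrite /inst !subst_num_rosser; apply.
  by apply: ent_hyp; right; left.
apply: (ent_impE (A := inst Pr (quote diag_sentence))).
  by apply: ent_weak d _ => D; right; right; right.
exact: ent_eq (ent_diag_code dx du) (ent_hd _ _ _).
Qed.

End Diagonal.

Theorem proposition3p9 (S T : theory) (Pr : formula)
  (hS : consistent_ce_extension_of_PA S)
  (hT : consistent_ce_extension_of_PA T)
  (hST : extends T S)
  (hPr : provability_predicate S T Pr)
  (hSigma1 : Sigma1 Pr)
  (hCB : CB S Pr) :
  exists C : formula, RFN_Delta0 Pr C /\ ~ proves T C.
Proof.
have [sT conT _ TPA] := hT; have [bPr PrP] := hPr.
have [n [B [dB ePr]]] := hSigma1; rewrite {}ePr in bPr PrP hCB *.
have bB : bounded n.+1 B by rewrite bounded_ExN addn1 in bPr.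
pose M := diag_matrix n B; have bM := bounded_diag_matrix bB.
exists (AllN n.+3 (Imp (at_dot (ExN n B) n.+3 M) M)); split.
  by exists n.+3, M; split=> //; apply: Delta0_diag_matrix.
move=> rfn; pose P := inst (ExN n B) (quote (diag_sentence n B)).
have PM : ent T [:: P] (diag_sentence n B).
  (* [AllN n.+3 M] is [diag_sentence n B] by conversion, so [CB] speaks of exactly the sentence
     quoted in [P]. *)
  have := ent_impE (ent0 [:: P] (hST _ (hCB _ _ bM))) (ent_hd _ _ _).
  (* The conclusion of [CB] and the premise of reflection are the same [at_dot] formula, so modus
     ponens under the opened prefix joins them. *)
  move=> /(ent_allN_E sT) d; apply: ent_allN_I => //; apply: ent_impE d.
  by have := ent_allN_E sT (ent0 [:: P] rfn).
have nP : ent T [::] (Neg P).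
  by apply: ent_impI; apply: ent_diag_elim PM (ent_hd _ _ _).
have dM := ent_diag_intro bB sT TPA nP.
by apply: conT; apply: ent_impE nP (hST _ ((PrP _).1 dM)).
Qed.
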